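(* Let $D$ be a non-commutative division ring with center $F$ and let $M$ be an irreducible metabelian locally solvable maximal subgroup of $D^*$. If there exists an element $\alpha\in M\setminus F$ that is algebraic over $F$, then $[D:F]<\infty$.
   Context: $D^*$ is the multiplicative group of $D$; maximal subgroup = proper subgroup maximal among proper subgroups. A subgroup $G\le D^*$ is irreducible if the division subring $F(G)$ generated by $F\cup G$ equals $D$. Locally solvable: every finitely generated subgroup solvable. Metabelian: the derived subgroup is abelian. *)

(* Defs.v *)
From HB Require Import structures.
From mathcomp Require Import all_boot all_order all_algebra.
Set Implicit Arguments. Unset Strict Implicit. Unset Printing Implicit Defensive.
Import GRing.Theory.
Local Open Scope ring_scope.

Section Defs.
Variable D : unitRingType.

Definition is_division_ring : Prop := forall x : D, x != 0 -> x \is a GRing.unit.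

Definition central (x : D) : Prop := forall y : D, x * y = y * x.

Definition is_subgroup (H : D -> Prop) : Prop :=
  [/\ H 1, (forall x, H x -> x != 0),
      (forall x y, H x -> H y -> H (x * y)) & (forall x, H x -> H x^-1)].

Definition maximal_subgroup (M : D -> Prop) : Prop :=
  [/\ is_subgroup M, (exists x, x != 0 /\ ~ M x) &
      forall H, is_subgroup H -> (forall x, M x -> H x) ->
        (forall x, H x <-> M x) \/ (forall x, H x <-> x != 0)].

Definition gen_subgroup (S : D -> Prop) : D -> Prop :=
  fun x => forall H, is_subgroup H -> (forall y, S y -> H y) -> H x.

Definition derived (H : D -> Prop) : D -> Prop :=
  gen_subgroup (fun z => exists x y, [/\ H x, H y & z = x^-1 * y^-1 * x * y]).

Fixpoint derived_iter (n : nat) (H : D -> Prop) : D -> Prop :=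
  match n with 0 => H | n'.+1 => derived (derived_iter n' H) end.

Definition solvable_group (H : D -> Prop) : Prop :=
  exists n, forall x, derived_iter n H x -> x = 1.

Definition locally_solvable (M : D -> Prop) : Prop :=
  forall s : seq D, (forall x, x \in s -> M x) ->
    solvable_group (gen_subgroup (fun x => x \in s)).

Definition metabelian (M : D -> Prop) : Prop :=
  forall x y, derived M x -> derived M y -> x * y = y * x.

Definition is_division_subring (S : D -> Prop) : Prop :=
  [/\ S 0, S 1, (forall x y, S x -> S y -> S (x - y)),
      (forall x y, S x -> S y -> S (x * y)) &
      (forall x, S x -> x != 0 -> S x^-1)].

Definition irreducible (M : D -> Prop) : Prop :=
  forall S, is_division_subring S -> (forall x, central x -> S x) ->
    (forall x, M x -> S x) -> forall x, S x.

Definition algebraic_over_center (a : D) : Prop :=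
  exists p : {poly D}, [/\ p != 0, (forall i, central p`_i) & p.[a] = 0].

Definition finite_dim_over_center : Prop :=
  exists s : seq D, forall x : D, exists c : seq D,
    [/\ size c = size s, (forall i, central c`_i) &
        x = \sum_(i < size s) c`_i * s`_i].

End Defs.

(* Main.v *)
Require Import Defs.
From mathcomp Require Import all_boot all_order all_algebra.
From mathcomp Require Import boolp.
Set Implicit Arguments. Unset Strict Implicit. Unset Printing Implicit Defensive.
Import GRing.Theory.
Local Open Scope ring_scope.

(** By maximality a division subring normalized by [M] is normalized by all of [D^*] or
has its units in [M]; by Cartan-Brauer-Hua and Hua's theorem it is therefore [D],
central, or commutative.  Applied to the centralizer of the commutators of [M] (or of
[a], when those commutators are central), this gives a maximal subfield [K] containing
[M'] and normalized by [M].  Some [m] in [M \ K] has a positive power in [K]: if [a] is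
outside [K], take [m = a], since otherwise the powers of [a] would be independent over
[K] (Dedekind); if [a] is in [K], its conjugates are roots of one polynomial, so each is
fixed by a power of any [m], and the centralizer of all of them is [K].  Let [m] have
order [n] modulo [K].  The elements of [K] commuting with [m] are central, so
conjugation by [m] makes [K] a cyclic extension of the center with a dual system
[sum_j s^i(x_j) b_j = delta_(i,0)], which yields both [K = sum_j F b_j] and
[D = sum_(i < n) m^i K]. *)

(** * Conjugation, centralizers and the Cartan-Brauer-Hua theorem *)

Section DivisionRing.
Variable D : unitRingType.
Hypothesis D_div : is_division_ring D.
Implicit Types (x y z a b c g m k : D) (S K E M : D -> Prop).

Definition conjr g x : D := g * x * g^-1.

Definition centralizer S x : Prop := forall y, S y -> x * y = y * x.

(** Only the inclusion of [g S g^-1] in [S] is asked; equality needs the same for [g^-1]. *)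
Definition normalizes g S : Prop := forall x, S x -> S (conjr g x).

Lemma divr_mulf_eq0 x y : x * y = 0 -> x = 0 \/ y = 0.
Proof.
have [->|x0] := eqVneq x 0; first by left.
by move=> /(congr1 ( *%R x^-1)); rewrite mulKr ?D_div // mulr0; right.
Qed.

Lemma divr_mulf_neq0 x y : x != 0 -> y != 0 -> x * y != 0.
Proof.
move=> x0 y0; apply/eqP => /divr_mulf_eq0 [] /eqP; first exact/negP.
exact/negP.
Qed.

Lemma divr_expf_neq0 x n : x != 0 -> x ^+ n != 0.
Proof.
by move=> x0; elim: n => [|n IH]; rewrite ?expr0 ?oner_neq0 // exprS divr_mulf_neq0.
Qed.

Lemma divr_invr_neq0 x : x != 0 -> x^-1 != 0.
Proof. by move=> x0; rewrite invr_eq0. Qed.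

Lemma conjr_sum g (I : Type) (r : seq I) (F : I -> D) :
  conjr g (\sum_(i <- r) F i) = \sum_(i <- r) conjr g (F i).
Proof. by rewrite /conjr mulr_sumr mulr_suml. Qed.

Lemma conjrM g x y : g != 0 -> conjr g (x * y) = conjr g x * conjr g y.
Proof. by move=> g0; rewrite /conjr !mulrA mulrVK ?D_div. Qed.

Lemma conjr_comp g h x : g != 0 -> h != 0 -> conjr (g * h) x = conjr g (conjr h x).
Proof. by move=> g0 h0; rewrite /conjr invrM ?D_div // !mulrA. Qed.

Lemma conjrK g x : g != 0 -> conjr g^-1 (conjr g x) = x.
Proof. by move=> g0; rewrite /conjr invrK !mulrA mulVr ?D_div // mul1r mulrVK ?D_div. Qed.

Lemma conjrVK g x : g != 0 -> conjr g (conjr g^-1 x) = x.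
Proof. by move=> g0; rewrite -{1}[g]invrK conjrK // invr_eq0. Qed.

Lemma conjr_comm g x : g != 0 -> (conjr g x = x) <-> (g * x = x * g).
Proof.
move=> g0; split; rewrite /conjr; last by move->; rewrite mulrK ?D_div.
by move=> h; rewrite -{2}h mulrVK ?D_div.
Qed.

Lemma conjr_eq_comm g x y : g != 0 ->
  conjr g x * conjr g y = conjr g y * conjr g x -> x * y = y * x.
Proof.
move=> g0; rewrite -!conjrM // => /(congr1 (conjr g^-1)).
by rewrite !conjrK.
Qed.

Lemma conjr_centralizer g S : g != 0 -> normalizes g^-1 S ->
  normalizes g (centralizer S).
Proof.
move=> g0 nS x cx y Sy; apply: (@conjr_eq_comm g^-1); first exact: divr_invr_neq0.
by rewrite conjrK //; apply/cx/nS.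
Qed.

Lemma centralizer_division S : is_division_subring (centralizer S).
Proof.
split=> [y _|y _|x y cx cy z Sz|x y cx cy z Sz|x cx x0 z Sz].
- by rewrite mul0r mulr0.
- by rewrite mul1r mulr1.
- by rewrite mulrBl mulrBr cx // cy.
- by rewrite -mulrA cy // mulrA cx // mulrA.
- exact/commr_sym/commrV/commr_sym/cx.
Qed.

Section Subring.
Variables (S : D -> Prop) (S_div : is_division_subring S).

Lemma dsub0 : S 0. Proof. by case: S_div. Qed.
Lemma dsub1 : S 1. Proof. by case: S_div. Qed.
Lemma dsubB x y : S x -> S y -> S (x - y). Proof. by case: S_div => _ _ h _ _; exact: h. Qed.
Lemma dsubM x y : S x -> S y -> S (x * y). Proof. by case: S_div => _ _ _ h _; exact: h. Qed.
Lemma dsubV x : S x -> S x^-1.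
Proof.
have [->|x0] := eqVneq x 0; first by rewrite invr0.
by case: S_div => _ _ _ _ h Sx; exact: h.
Qed.
Lemma dsubN x : S x -> S (- x).
Proof. by move=> Sx; rewrite -sub0r; apply: dsubB => //; exact: dsub0. Qed.
Lemma dsubD x y : S x -> S y -> S (x + y).
Proof. by move=> Sx Sy; rewrite -[y]opprK; apply/dsubB/dsubN. Qed.
Lemma dsub_sum (I : Type) (r : seq I) (F : I -> D) :
  (forall i, S (F i)) -> S (\sum_(i <- r) F i).
Proof. by move=> SF; elim/big_ind: _ => //; [exact: dsub0|exact: dsubD]. Qed.
End Subring.

(** Conjugation by [g] is a ring automorphism fixing the central coefficients, so it permutes the
    roots of [p]. *)
Lemma horner_conjr (p : {poly D}) g a :
  (forall i, central p`_i) -> g != 0 -> p.[conjr g a] = conjr g p.[a].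
Proof.
move=> pc g0; rewrite !horner_coef conjr_sum; apply: eq_bigr => j _.
rewrite conjrM //; congr (_ * _); first by apply/esym/conjr_comm => //; rewrite pc.
elim: (j : nat) => [|h IH]; first by rewrite !expr0 /conjr mulr1 mulrV ?D_div.
by rewrite !exprS conjrM // IH.
Qed.

(* For [e] outside [S], comparing the conjugates of [s] under [e] and [1 + e]
   expresses [e] through elements of [S] unless [e] commutes with [s]. *)
Lemma cartan_brauer_hua E S :
  is_division_subring E -> is_division_subring S ->
  (forall e, E e -> e != 0 -> normalizes e S) ->
  (forall x, E x -> S x) \/ (forall x s, E x -> S s -> x * s = s * x).
Proof.
move=> dE dS nS.
have out e s : E e -> ~ S e -> S s -> e * s = s * e.
  move=> Ee nSe Ss.
  have e0 : e != 0 by apply/eqP => e0; apply: nSe; rewrite e0; exact: dsub0.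
  have f0 : 1 + e != 0.
    apply/eqP => /eqP; rewrite addrC addr_eq0 => /eqP eN; apply: nSe.
    by rewrite eN; apply: dsubN => //; exact: dsub1.
  have St := nS _ Ee e0 _ Ss.
  have Su := nS _ (dsubD dE (dsub1 dE) Ee) f0 _ Ss.
  set t := conjr e s in St; set u := conjr (1 + e) s in Su.
  have te : t * e = e * s by rewrite /t /conjr mulrVK ?D_div.
  have : u * (1 + e) = (1 + e) * s by rewrite /u /conjr mulrVK ?D_div.
  rewrite mulrDl mul1r mulrDr mulr1 -te => ue.
  have key : (t - u) * e = u - s.
    by apply/eqP; rewrite mulrBl subr_eq addrAC eq_sym subr_eq ue addrC.
  have [tu|tu] := eqVneq t u.
    move: key; rewrite tu subrr mul0r => /esym/eqP; rewrite subr_eq0 => /eqP us.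
    by rewrite us.
  case: nSe; rewrite -[e](mulKr (D_div (x := t - u) _)) ?subr_eq0 // key.
  by apply: dsubM => //; [apply: dsubV => //|]; exact: dsubB.
have [sub|nsub] := pselect (forall x, E x -> S x); [by left|right=> x s Ex Ss].
have [Sx|nSx] := pselect (S x); last exact: out.
have [e nESe] : exists e, ~ (E e -> S e) by apply/existsNP.
have [Ee nSe] : E e /\ ~ S e by apply/not_implyP.
(* Both [e] and [e + x] lie in [E] outside [S], hence commute with [s]; so does their difference
   [x]. *)
have := out (e + x) s (dsubD dE Ee Ex) _ Ss.
rewrite mulrDl mulrDr out // => h; apply/addrI/h => Sex; apply: nSe.
by rewrite -(addrK x e); exact: dsubB.
Qed.

(** * Commutators and Hua's theorem *)

Definition commg x y : D := x^-1 * y^-1 * x * y.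

Definition commutators M z : Prop := exists x y, [/\ M x, M y & z = commg x y].

Lemma mul_commg x y : x != 0 -> y != 0 -> y * x * commg x y = x * y.
Proof.
by move=> x0 y0; rewrite /commg !mulrA mulrK ?mulrV ?D_div // mul1r.
Qed.

Lemma conjr_commg g x y : g != 0 -> conjr g (commg x y) = commg (conjr g x) (conjr g y).
Proof.
move=> g0; have cV z : conjr g z^-1 = (conjr g z)^-1.
  have [->|z0] := eqVneq z 0; first by rewrite /conjr mulr0 mul0r invr0 mulr0 mul0r.
  by rewrite /conjr !invrM ?unitrMl ?unitrV ?D_div // invrK mulrA.
by rewrite /commg !conjrM // !cV.
Qed.

(* As in the Cartan-Brauer-Hua theorem: compare the commutators of [x] with [y]
   and with [1 + y]. *)
Lemma central_commutators_comm E : is_division_subring E ->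
  (forall x y z, E x -> x != 0 -> E y -> y != 0 -> E z ->
     commg x y * z = z * commg x y) ->
  forall x y, E x -> E y -> x * y = y * x.
Proof.
move=> dE cE x y Ex Ey.
have [->|x0] := eqVneq x 0; first by rewrite mul0r mulr0.
have [->|y0] := eqVneq y 0; first by rewrite mul0r mulr0.
have [y1|y1] := eqVneq (1 + y) 0.
  by rewrite -[y](addKr 1) y1 addr0 mulrN mulNr mul1r mulr1.
have E1y := dsubD dE (dsub1 dE) Ey.
have hc := mul_commg x0 y0; have hd := mul_commg x0 y1.
have cc := cE x y _ Ex x0 Ey y0; have cd := cE x _ _ Ex x0 E1y y1.
move: (commg x y) (commg x (1 + y)) hc hd cc cd => c d hc hd cc cd.
have key : y * (x * (d - c)) = x * (1 - d).
  move: hd; rewrite mulrDl mul1r mulrDl mulrDr mulr1 -hc => hd.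
  apply/eqP; rewrite !mulrBr mulr1 !mulrA subr_eq addrAC eq_sym subr_eq -hd.
  by rewrite addrC.
have [dc|dc] := eqVneq d c.
  move: key; rewrite dc subrr !mulr0 => /esym/divr_mulf_eq0 [/eqP|/eqP].
    by rewrite (negPf x0).
  by rewrite subr_eq0 => /eqP c1; rewrite -hc -c1 mulr1.
have u0 : x * (d - c) != 0 by rewrite divr_mulf_neq0 ?subr_eq0.
(* This writes [y] rationally in [x], [c] and [d], all of which commute with [x]. *)
have -> : y = x * (1 - d) / (x * (d - c)) by rewrite -key mulrK ?D_div.
have xd : x * d = d * x by rewrite cd.
have xc : x * c = c * x by rewrite cc.
apply: commrM; first by apply: commrM => //; apply: commrB; rewrite /GRing.comm ?mulr1 ?mul1r.
by apply/commrV/commrM => //; apply: commrB.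
Qed.

(** The centralizer of the commutators of [E^*] is normalized by [E^*] and, by hypothesis, contains
    these commutators. Either alternative of [cartan_brauer_hua] then makes them commute with all of
    [E]. *)
Lemma hua_metabelian E : is_division_subring E ->
  (forall c d, commutators (fun x => E x /\ x != 0) c ->
               commutators (fun x => E x /\ x != 0) d -> c * d = d * c) ->
  forall x y, E x -> E y -> x * y = y * x.
Proof.
move=> dE mE; set U := fun x => E x /\ x != 0 in mE.
have nU g : U g -> normalizes g^-1 (commutators U).
  case=> Eg g0 _ [x [y [[Ex x0] [Ey y0] ->]]].
  have EV := dsubV dE Eg; have gV0 := divr_invr_neq0 g0.
  have Uc z : E z -> z != 0 -> U (conjr g^-1 z).
    move=> Ez z0; split; first by rewrite /conjr invrK; do 2 apply: dsubM => //.
    by rewrite /conjr invrK; do 2 apply: divr_mulf_neq0 => //.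
  by exists (conjr g^-1 x), (conjr g^-1 y); split; rewrite ?conjr_commg //; exact: Uc.
have nC g : E g -> g != 0 -> normalizes g (centralizer (commutators U)).
  by move=> Eg g0; apply: conjr_centralizer => //; apply: nU.
have cU x z : E x -> commutators U z -> z * x = x * z.
  move=> Ex cz.
  have [sub|cen] := cartan_brauer_hua dE (centralizer_division _) nC.
    by rewrite (sub x Ex).
  by rewrite (cen x z) // => y cy; exact: mE.
apply: central_commutators_comm => // x y z Ex x0 Ey y0 Ez.
by apply: cU => //; exists x, y.
Qed.

Lemma finite_dim_of_spanning (T : eqType) (r : seq T) (f : T -> D) :
  (forall x, exists2 c : T -> D, (forall t, t \in r -> central (c t)) &
                                 x = \sum_(t <- r) c t * f t) ->
  finite_dim_over_center D.
Proof.
move=> span; exists (map f r) => x; have [c cc ->] := span x.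
exists (map c r); split; first by rewrite !size_map.
  move=> i; have [ltir|leri] := ltnP i (size (map c r)).
    by have /mapP [t /cc ct ->] := mem_nth 0 ltir.
  by rewrite nth_default // => y; rewrite mul0r mulr0.
rewrite size_map; elim: r {span cc} => [|t r IH] /=; first by rewrite big_nil big_ord0.
by rewrite big_cons big_ord_recl IH.
Qed.

(** * Self-centralizing subfields, dual systems and cyclic crossed products *)

Section MaximalSubfield.
Variable K : D -> Prop.
Hypothesis K_div : is_division_subring K.
Hypothesis K_comm : forall x y, K x -> K y -> x * y = y * x.
Hypothesis K_selfcent : forall x, (forall y, K y -> x * y = y * x) -> K x.

(** Otherwise [g] would centralize [K] and so lie in it. *)
Lemma conjr_moves g : g != 0 -> ~ K g -> exists2 y, K y & conjr g y != y.
Proof.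
move=> g0 nKg; apply: contrapT => nex; apply: nKg; apply: K_selfcent => y Ky.
apply/conjr_comm => //; apply/eqP; apply: contrapT => /negP ny; apply: nex.
by exists y.
Qed.

(* The pairs [p] stand for the tensor [sum p.1 (x) p.2]; each [g] contributes the
   factor [(1 (x) g a - a (x) 1) / (g a - a)], which is killed by [g (x) 1] and
   sent to 1 by multiplication. *)
Lemma dual_system (l : seq D) :
  (forall g, g \in l -> [/\ g != 0, ~ K g & normalizes g K]) ->
  exists r : seq (D * D),
    [/\ forall p, p \in r -> K p.1 /\ K p.2, \sum_(p <- r) p.1 * p.2 = 1 &
        forall g, g \in l -> \sum_(p <- r) conjr g p.1 * p.2 = 0].
Proof.
elim: l => [_|g l IH hl].
  exists [:: (1, 1)]; split=> [p|//|//]; last by rewrite big_seq1 mulr1.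
  by rewrite inE => /eqP ->; split; exact: dsub1.
have [h hh|r [Kr r1 rl]] := IH; first by apply: hl; rewrite inE hh orbT.
have [g0 nKg ng] := hl g (mem_head _ _).
have [a Ka aga] := conjr_moves g0 nKg.
have Kga := ng _ Ka.
have [c Kc ca] : exists2 c, K c & c * (conjr g a - a) = 1.
  exists (conjr g a - a)^-1; first by apply: dsubV => //; exact: dsubB.
  by rewrite mulVr // D_div // subr_eq0.
pose r' := [seq (p.1, c * conjr g a * p.2) | p <- r] ++ [seq (a * p.1, - c * p.2) | p <- r].
have Kr' p : p \in r' -> K p.1 /\ K p.2.
  rewrite mem_cat => /orP [] /mapP [q /Kr [K1 K2] ->] /=; split=> //.
  - by do 2 apply: dsubM => //.
  - exact: dsubM.
  - by apply: dsubM => //; exact: dsubN.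
(* For [f] the identity the new factor is 1; for conjugation by [g] it is 0; any other conjugation
   keeps the 0 it had on [r]. *)
have sumr' (f : D -> D) : (forall x, K x -> K (f x)) ->
    (forall x, K x -> f (a * x) = f a * f x) ->
    \sum_(p <- r') f p.1 * p.2 =
    c * (conjr g a - f a) * \sum_(p <- r) f p.1 * p.2.
  move=> Kf fM; rewrite /r' big_cat /= !big_map mulr_sumr -big_split /=.
  rewrite !big_seq; apply: eq_bigr => p /Kr [K1 K2] /=.
  have Kfp := Kf _ K1; have Kfa := Kf _ Ka.
  have e1 : f p.1 * (c * conjr g a) = c * conjr g a * f p.1.
    by apply: K_comm => //; exact: dsubM.
  have e2 : f a * f p.1 * c = c * (f a * f p.1).
    by apply: K_comm => //; exact: dsubM.
  rewrite fM //; move: (conjr g a) (f a) (f p.1) e1 e2 => ga fa fp e1 e2.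
  by rewrite mulrBr mulrBl !mulNr mulrN !mulrA -e1 mulrA e2 !mulrA.
exists r'; split=> // [|h].
  by rewrite (sumr' id) // r1 mulr1 ca.
have sumh : h \in g :: l -> \sum_(p <- r') conjr h p.1 * p.2 =
    c * (conjr g a - conjr h a) * \sum_(p <- r) conjr h p.1 * p.2.
  move=> hh; have [h0 _ nh] := hl h hh.
  by apply: sumr' => // x _; exact: conjrM.
move=> hh; rewrite sumh //; move: hh; rewrite inE => /orP [/eqP ->|/rl ->].
  by rewrite subrr mulr0 mul0r.
by rewrite mulr0.
Qed.

Lemma normalizesX g i : g != 0 -> normalizes g K -> normalizes (g ^+ i) K.
Proof.
move=> g0 ng; elim: i => [|i IH] x Kx.
  by rewrite /conjr expr0 mul1r invr1 mulr1.
by rewrite exprS conjr_comp ?divr_expf_neq0 //; apply/ng/IH.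
Qed.

(** Here [n.+1] is the order of [m] modulo [K]. The dual system consists of trace-dual families
    [x_j], [b_j] of [K] over the center, and the products [m^i b_j] span [D]. *)
Lemma crossed_product_finite_dim m n :
  m != 0 -> normalizes m K -> normalizes m^-1 K ->
  K (m ^+ n.+1) -> (forall i, (i < n)%N -> ~ K (m ^+ i.+1)) ->
  (forall y, K y -> m * y = y * m -> central y) ->
  finite_dim_over_center D.
Proof.
move=> m0 nm nmV Kmn nKm fixC.
have mX0 i : m ^+ i != 0 by exact: divr_expf_neq0.
have nmX i : normalizes (m ^+ i) K by exact: normalizesX.
have nmVX i : normalizes (m ^+ i)^-1 K.
  by rewrite -exprVn; apply: normalizesX => //; exact: divr_invr_neq0.
(* The relations for the inverse powers, conjugated by [m ^+ i.+1], move the automorphism onto the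
   second factor; this is [rsV]. *)
pose l := [seq m ^+ i.+1 | i <- iota 0 n] ++ [seq (m ^+ i.+1)^-1 | i <- iota 0 n].
have [g|r [Kr r1 rl]] := @dual_system l.
  rewrite mem_cat => /orP [] /mapP [i]; rewrite mem_iota => /andP [_ ltin] ->.
    by split=> //; exact: nKm.
  split=> //; first exact: divr_invr_neq0.
  by move=> /(dsubV K_div); rewrite invrK; exact: nKm.
have rs i : (i < n)%N -> \sum_(p <- r) conjr (m ^+ i.+1) p.1 * p.2 = 0.
  move=> ltin; apply: rl; rewrite mem_cat; apply/orP; left;
  by apply/mapP; exists i; rewrite ?mem_iota.
have rsV i : (i < n)%N -> \sum_(p <- r) p.1 * conjr (m ^+ i.+1) p.2 = 0.
  move=> ltin; have /(congr1 (conjr (m ^+ i.+1))) :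
      \sum_(p <- r) conjr (m ^+ i.+1)^-1 p.1 * p.2 = 0.
    by apply: rl; rewrite mem_cat; apply/orP; right; apply/mapP; exists i; rewrite ?mem_iota.
  rewrite conjr_sum [X in _ = X]/conjr mulr0 mul0r => h; rewrite -[RHS]h; apply: eq_bigr => p _.
  by rewrite conjrM // conjrVK.
have conj0 y : conjr (m ^+ 0) y = y by rewrite /conjr expr0 mul1r invr1 mulr1.
(* The trace of the cyclic action of [m] on [K]. Conjugation by [m] permutes its terms cyclically,
   since [m ^+ n.+1] acts trivially on [K]. *)
pose Tr y := \sum_(i < n.+1) conjr (m ^+ i) y.
have TrC y : K y -> central (Tr y).
  move=> Ky; apply: fixC; first by apply: dsub_sum => // i; exact: nmX.
  apply/conjr_comm => //; rewrite /Tr conjr_sum big_ord_recr [RHS]big_ord_recl /= addrC.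
  rewrite -conjr_comp // -exprS conj0; congr (_ + _).
    by apply/conjr_comm => //; exact: K_comm.
  by apply: eq_bigr => i _; rewrite -conjr_comp // -exprS.
(* After exchanging the sums, only the term of the identity automorphism survives. *)
have dual1 y : K y -> \sum_(p <- r) Tr (y * p.1) * p.2 = y.
  move=> Ky; under eq_bigr do rewrite mulr_suml.
  rewrite exchange_big big_ord_recl /= [X in _ + X]big1 ?addr0.
    by under eq_bigr do rewrite conj0 -mulrA; rewrite -mulr_sumr r1 mulr1.
  move=> i _; under eq_bigr do rewrite conjrM // -mulrA.
  by rewrite -mulr_sumr rs ?mulr0.
have dual2 y : K y -> \sum_(p <- r) p.1 * Tr (p.2 * y) = y.
  move=> Ky; under eq_bigr do rewrite mulr_sumr.
  rewrite exchange_big big_ord_recl /= [X in _ + X]big1 ?addr0.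
    by under eq_bigr do rewrite conj0 mulrA; rewrite -mulr_suml r1 mul1r.
  move=> i _; under eq_bigr do rewrite conjrM // mulrA.
  by rewrite -mulr_suml rsV ?mul0r.
(* [sum_j k x_j (x) b_j = sum_j x_j (x) b_j k], so the sum commutes with [K]. *)
have projK d : K (\sum_(p <- r) p.1 * d * p.2).
  apply: K_selfcent => k Kk; rewrite mulr_suml mulr_sumr.
  transitivity (\sum_(p <- r) \sum_(q <- r) p.1 * Tr (p.2 * (k * q.1)) * d * q.2).
    rewrite !big_seq; apply: eq_bigr => p /Kr [K1 K2].
    rewrite -mulrA -{1}(dual1 (p.2 * k)); last exact: dsubM.
    rewrite mulr_sumr !big_seq.
    apply: eq_bigr => q /Kr [Kq1 Kq2].
    have cT : central (Tr (p.2 * (k * q.1))) by apply: TrC; do 2 apply: dsubM => //.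
    by rewrite -[p.2 * k * _]mulrA mulrA -[p.1 * d * _]mulrA -[d * _]cT !mulrA.
  rewrite exchange_big /= !big_seq; apply: eq_bigr => q /Kr [Kq1 Kq2].
  by rewrite -!mulr_suml dual2 ?mulrA //; exact: dsubM.
apply: (@finite_dim_of_spanning (nat * (D * D))%type [seq (i, p) | i <- index_iota 0 n.+1, p <- r]
  (fun t => m ^+ t.1 * t.2.2)) => d.
pose e i := \sum_(p <- r) p.1 * ((m ^+ i)^-1 * d) * p.2.
(* Write [d] as [d * 1] with [1 = sum_j Tr(x_j) b_j], pull the central traces to the left and expand
   them. *)
have dE : d = \sum_(i < n.+1) m ^+ i * e i.
  rewrite -[LHS]mulr1 -(dual1 1); last exact: dsub1.
  rewrite mulr_sumr.
  under [RHS]eq_bigr do rewrite mulr_sumr.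
  rewrite exchange_big /= !big_seq; apply: eq_bigr => p /Kr [K1 K2].
  have cT : central (Tr (1 * p.1)) by apply: TrC; rewrite mul1r.
  rewrite mulrA -cT mul1r !mulr_suml; apply: eq_bigr => i _.
  by rewrite /conjr !mulrA.
exists (fun t => Tr (e t.1 * t.2.1)).
  by move=> _ /allpairsP [[i p] [_ /Kr [K1 _] ->]]; apply: TrC; apply: dsubM => //; exact: projK.
rewrite big_allpairs_dep big_mkord {1}dE.
apply: eq_bigr => i _; rewrite -{1}(dual1 (e i)); last exact: projK.
rewrite mulr_sumr !big_seq.
apply: eq_bigr => p /Kr [K1 _].
have cT : central (Tr (e i * p.1)) by apply: TrC; apply: dsubM => //; exact: projK.
by rewrite mulrA -cT mulrA.
Qed.

(** Dedekind's argument: the relation times [y] on the right, minus [conjr (g ^+ N) y] times the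
    relation, loses its top term, and induction applies. *)
Lemma powers_independent g (k : nat -> D) N :
  g != 0 -> normalizes g K -> (forall i, ~ K (g ^+ i.+1)) -> (forall i, K (k i)) ->
  \sum_(i < N) k i * g ^+ i = 0 -> forall i, (i < N)%N -> k i = 0.
Proof.
move=> g0 ng nKg; elim: N k => [|N IH] k Kk sum0 i //.
have gX j : g ^+ j != 0 by exact: divr_expf_neq0.
have ngX j : normalizes (g ^+ j) K by exact: normalizesX.
have kj j : (j < N)%N -> k j = 0.
  (* Since [g ^+ (N - j)] moves [y], conjugations by [g ^+ j] and [g ^+ N] differ at [y], so the
     vanishing new coefficient forces [k j = 0]. *)
  move=> ltjN; have [y Ky ny] : exists2 y, K y & conjr (g ^+ (N - j)) y != y.
    by apply: conjr_moves => //; rewrite -(subnSK ltjN).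
  have : k j * (conjr (g ^+ j) y - conjr (g ^+ N) y) = 0.
    apply: (IH (fun i => k i * (conjr (g ^+ i) y - conjr (g ^+ N) y))) => // [h|].
      by apply: dsubM => //; apply: dsubB => //; exact: ngX.
    transitivity ((\sum_(i < N.+1) k i * g ^+ i) * y -
                  conjr (g ^+ N) y * \sum_(i < N.+1) k i * g ^+ i); last first.
      by rewrite sum0 mul0r mulr0 subrr.
    have term h : k h * g ^+ h * y - conjr (g ^+ N) y * (k h * g ^+ h) =
                  k h * (conjr (g ^+ h) y - conjr (g ^+ N) y) * g ^+ h.
      have e1 : conjr (g ^+ h) y * g ^+ h = g ^+ h * y by rewrite /conjr mulrVK ?D_div.
      have e2 : k h * conjr (g ^+ N) y = conjr (g ^+ N) y * k h.
        by apply: K_comm => //; exact: ngX.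
      move: (conjr (g ^+ N) y) (conjr (g ^+ h) y) e1 e2 => u v e1 e2.
      by rewrite mulrBr mulrBl e2 -!mulrA e1.
    rewrite mulr_suml mulr_sumr -sumrB [RHS]big_ord_recr /= term subrr mulr0 mul0r addr0.
    by apply: eq_bigr => h _; rewrite term.
  case/divr_mulf_eq0 => // /eqP; rewrite subr_eq0 => /eqP eqy.
  case/eqP: ny; move/(congr1 (conjr (g ^+ j)^-1)): eqy; rewrite conjrK //.
  by rewrite -{1}(subnKC (ltnW ltjN)) exprD conjr_comp // conjrK // => /esym.
rewrite ltnS leq_eqVlt => /orP [/eqP ->|]; last exact: kj.
move: sum0; rewrite big_ord_recr big1 /= ?add0r => [|h _]; last by rewrite kj ?mul0r.
by case/divr_mulf_eq0 => // /eqP; rewrite (negPf (gX N)).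
Qed.

(** Among [size p] conjugates of [a], all roots of [p] in [K], two coincide, so [a] has a period
    below [size p]. The factorial is a multiple of every such period and depends on [p] alone. *)
Lemma conj_period (p : {poly D}) m a :
  p != 0 -> (forall i, central p`_i) -> p.[a] = 0 -> K a ->
  m != 0 -> normalizes m K -> m ^+ (size p)`! * a = a * m ^+ (size p)`!.
Proof.
move=> p0 pc pa Ka m0 nm.
have mX j : m ^+ j != 0 by exact: divr_expf_neq0.
pose rs := [seq conjr (m ^+ i) a | i <- iota 0 (size p)].
have Krs x : x \in rs -> K x by case/mapP => i _ ->; apply: normalizesX.
have rootrs : all (root p) rs.
  apply/allP => _ /mapP [i _ ->]; apply/rootP.
  by rewrite horner_conjr // pa /conjr mulr0 mul0r.
have nuniq : ~~ uniq rs.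
  apply/negP => urs; have : uniq_roots rs.
    (* Over a noncommutative ring the root bound asks for roots that commute and differ by units:
       [K] gives the first, division the second. *)
    elim: (rs) urs Krs => //= x s IH /andP [xs us] Ks.
    rewrite IH // ?andbT => [|y ys]; last by apply: Ks; rewrite inE ys orbT.
    apply/allP => y ys; rewrite /diff_roots (K_comm (Ks x _) (Ks y _)).
    - rewrite eqxx D_div // subr_eq0; by apply: contraNneq xs => <-.
    - exact: mem_head.
    - by rewrite inE ys orbT.
  move/(max_ring_poly_roots p0 rootrs).
  by rewrite size_map size_iota ltnn.
have [i [j [ltij ltj]]] := uniqPn 0 nuniq.
rewrite size_map size_iota in ltj; have lti := ltn_trans ltij ltj.
rewrite !(nth_map 0%N) ?size_iota // !nth_iota // !add0n => eqij.
have e : conjr (m ^+ (j - i)) a = a.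
  move/(congr1 (conjr (m ^+ i)^-1)): eqij; rewrite conjrK //.
  by rewrite -{1}(subnKC (ltnW ltij)) exprD conjr_comp // conjrK.
have cmm : m ^+ (j - i) * a = a * m ^+ (j - i) by apply/conjr_comm.
have /dvdnP [q ->] : (j - i %| (size p)`!)%N.
  by apply: dvdn_fact; rewrite subn_gt0 ltij (leq_trans (leq_subr _ _)) // ltnW.
by rewrite mulnC exprM; apply/commr_sym/commrX.
Qed.

End MaximalSubfield.

(** * Division subrings normalized by a maximal subgroup *)

Section MaximalSubgroup.
Variable M : D -> Prop.
Hypotheses (M_max : maximal_subgroup M) (M_metab : metabelian M).

Lemma msub_neq0 x : M x -> x != 0. Proof. by case: M_max => [[_ h _ _] _ _]; exact: h. Qed.
Lemma msubM x y : M x -> M y -> M (x * y). Proof. by case: M_max => [[_ _ h _] _ _]; exact: h. Qed.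
Lemma msubV x : M x -> M x^-1. Proof. by case: M_max => [[_ _ _ h] _ _]; exact: h. Qed.

Lemma commutators_comm x y : commutators M x -> commutators M y -> x * y = y * x.
Proof.
have der z : commutators M z -> derived M z by move=> cz H _; apply.
by move=> /der dx /der dy; exact: M_metab.
Qed.

Lemma normalized_trichotomy S : is_division_subring S ->
  (forall g, M g -> normalizes g S) ->
  [\/ forall x, S x, forall x, S x -> central x |
      (forall x, S x -> x != 0 -> M x) /\ (forall x y, S x -> S y -> x * y = y * x)].
Proof.
move=> dS nS; pose H g := [/\ g != 0, normalizes g S & normalizes g^-1 S].
have H_sub : is_subgroup H.
  split=> [|x []//|x y [x0 nx nVx] [y0 ny nVy]|x [x0 nx nVx]].
  - by split; rewrite ?oner_neq0 // => x Sx; rewrite /conjr ?invr1 mulr1 mul1r.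
  - split; first exact: divr_mulf_neq0.
      by move=> z Sz; rewrite conjr_comp //; apply/nx/ny.
    move=> z Sz; rewrite invrM ?D_div // conjr_comp ?divr_invr_neq0 //.
    by apply/nVy/nVx.
  - by split; rewrite ?invrK // divr_invr_neq0.
have [_ _ max] := M_max.
have [|HM|HD] := max H H_sub.
- by move=> x Mx; split; [exact: msub_neq0|exact: nS|exact/nS/msubV].
- have SM x : S x -> x != 0 -> M x.
    move=> Sx x0; apply/HM; split=> // y Sy; rewrite /conjr ?invrK;
    by do ![apply: dsubM => //]; exact: dsubV.
  constructor 3; split=> //; apply: hua_metabelian => // c d cc cd.
  have cM z : commutators (fun x => S x /\ x != 0) z -> commutators M z.
    by case=> x [y [[Sx x0] [Sy y0] ->]]; exists x, y; split=> //; exact: SM.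
  by apply: commutators_comm; exact: cM.
- have T_div : is_division_subring (fun _ : D => True) by [].
  have [|sub|cen] := @cartan_brauer_hua (fun=> True) S T_div dS.
  + by move=> e _ /HD [].
  + by constructor 1 => x; exact: sub.
  + by constructor 2 => x Sx y; apply/esym/cen.
Qed.

Definition normal_maximal_subfield K :=
  [/\ is_division_subring K, (forall x y, K x -> K y -> x * y = y * x),
      (forall x, (forall y, K y -> x * y = y * x) -> K x) &
      (forall g, M g -> normalizes g K)].

Lemma centralizer_maximal_subfield S :
  (forall g, M g -> normalizes g S) -> (forall x y, S x -> S y -> x * y = y * x) ->
  ~ (forall x, S x -> central x) -> normal_maximal_subfield (centralizer S).
Proof.
move=> nS cS nC.
have nK g : M g -> normalizes g (centralizer S).
  by move=> Mg; apply: conjr_centralizer; [exact: msub_neq0|exact/nS/msubV].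
have SK x : S x -> centralizer S x by move=> Sx y Sy; exact: cS.
have [all|cen|[_ cK]] := normalized_trichotomy (centralizer_division S) nK.
- by case: nC => x Sx y; apply/esym/all.
- by case: nC => x /SK /cen.
split=> //; first exact: centralizer_division.
by move=> x cx y Sy; apply/cx/SK.
Qed.

Lemma conjr_mul_commg g x : g != 0 -> x != 0 -> conjr g x = x * conjr g (commg g x).
Proof. by move=> g0 x0; rewrite /conjr -{1}(mul_commg g0 x0) !mulrA. Qed.

Lemma exists_normal_maximal_subfield a : M a -> ~ central a ->
  exists2 K, normal_maximal_subfield K & forall x, commutators M x -> K x.
Proof.
move=> Ma nca; have a0 := msub_neq0 Ma.
have nM g : M g -> normalizes g (commutators M).
  move=> Mg _ [x [y [Mx My ->]]].
  have Mc z : M z -> M (conjr g z) by move=> Mz; apply/msubM/msubV => //; exact: msubM.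
  exists (conjr g x), (conjr g y); rewrite conjr_commg ?msub_neq0 //.
  by split=> //; exact: Mc.
have [cC|ncC] := pselect (forall x, commutators M x -> central x); last first.
  exists (centralizer (commutators M)).
    by apply: centralizer_maximal_subfield => //; exact: commutators_comm.
  by move=> x cx y cy; exact: commutators_comm.
pose S x := exists2 c, central c & x = c * a.
exists (centralizer S); last by move=> x /cC cx y _; exact: cx.
apply: centralizer_maximal_subfield => [g Mg _ [c cc ->]|_ _ [c cc ->] [d cd ->]|cS].
- have g0 := msub_neq0 Mg.
  have cga : central (commg g a) by apply: cC; exists g, a.
  have cfix z : central z -> conjr g z = z by move=> cz; apply/conjr_comm.
  exists (c * commg g a); last first.
    by rewrite conjrM // cfix // conjr_mul_commg // cfix // -[RHS]mulrA cga.
  by move: (commg g a) cga => k ck y; rewrite -mulrA ck mulrA cc mulrA.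
- by rewrite !mulrA -(mulrA c a d) -(cd a) -(mulrA d a c) -(cc a) !mulrA (cc d).
- by apply/nca/cS; exists 1; rewrite ?mul1r // => y; rewrite mul1r mulr1.
Qed.

End MaximalSubgroup.
Lemma exists_power_in_maximal_subfield (M K : D -> Prop) (p : {poly D}) a :
  maximal_subgroup M -> irreducible M -> metabelian M ->
  (exists x y : D, x * y != y * x) -> normal_maximal_subfield M K ->
  M a -> ~ central a -> p != 0 -> (forall i, central p`_i) -> p.[a] = 0 ->
  exists m n, [/\ M m, ~ K m & K (m ^+ n.+1)].
Proof.
move=> Mmax Mirr Mmet [x0 [y0 nxy]] [dK cK sK nK] Ma nca p0 pc pa.
have centK x : central x -> K x by move=> cx; apply: sK => y _; exact: cx.
have [Ka|nKa] := pselect (K a); last first.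
  exists a; suff [n Kn] : exists n, K (a ^+ n.+1) by exists n.
  apply: contrapT => nex; case/eqP: p0; apply/polyP => i; rewrite coef0.
  have [ltip|] := ltnP i (size p); last exact: nth_default.
  apply: (@powers_independent K dK cK sK a (fun i => p`_i) (size p)) => //.
  - exact: (msub_neq0 Mmax).
  - exact: nK.
  - by move=> j Kj; apply: nex; exists j.
  - by move=> j; exact: centK.
  - by rewrite -horner_coef.
have [m Mm nKm] : exists2 m, M m & ~ K m.
  apply: contrapT => nex; case/eqP: nxy; apply: cK; apply: Mirr => // x Mx;
  by apply: contrapT => nKx; apply: nex; exists x.
have m0 := msub_neq0 Mmax Mm.
exists m, (size p)`!.-1; split=> //; rewrite prednK ?fact_gt0 //.
pose S x := exists2 g, M g & x = conjr g a.
have nS g : M g -> normalizes g S.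
  move=> Mg _ [h Mh ->]; exists (g * h); first exact: (msubM Mmax).
  by rewrite conjr_comp // (msub_neq0 Mmax).
have nE g : M g -> normalizes g (centralizer S).
  move=> Mg; apply: conjr_centralizer; first exact: (msub_neq0 Mmax).
  by apply/nS/(msubV Mmax).
have SK x : S x -> K x by case=> g Mg ->; exact: nK.
have KE x : K x -> centralizer S x by move=> Kx y /SK; exact: cK.
have Sa : S a by exists 1; [case: Mmax => [[]]|rewrite /conjr mul1r invr1 mulr1].
have Em : centralizer S (m ^+ (size p)`!).
  move=> _ [g Mg ->]; have g0 := msub_neq0 Mmax Mg.
  apply: (conj_period cK p0 pc) => //; [|exact: nK|exact: nK].
  by rewrite horner_conjr // pa /conjr mulr0 mul0r.
have [all|cen|[_ cE]] := normalized_trichotomy Mmax Mmet (centralizer_division S) nE.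
- by case: nca => y; apply/esym/all.
- by case: nca; exact/cen/KE.
by apply: sK => y /KE; exact: cE.
Qed.

End DivisionRing.

Theorem theorem2p6 (D : unitRingType) (M : D -> Prop) :
  is_division_ring D ->
  (exists x y : D, x * y != y * x) ->
  maximal_subgroup M -> irreducible M -> metabelian M -> locally_solvable M ->
  (exists a : D, [/\ M a, ~ central a & algebraic_over_center a]) ->
  finite_dim_over_center D.
Proof.
move=> D_div Dnc Mmax Mirr Mmet _ [a [Ma nca [p [p0 pc pa]]]].
have [K mK MK] := exists_normal_maximal_subfield D_div Mmax Mmet Ma nca.
have [m [n [Mm nKm Kmn]]] :=
  exists_power_in_maximal_subfield D_div Mmax Mirr Mmet Dnc mK Ma nca p0 pc pa.
have [dK cK sK nK] := mK.
have m0 := msub_neq0 Mmax Mm.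
have exn : exists n, `[< K (m ^+ n.+1) >] by exists n; apply/asboolP.
case: (ex_minnP exn) => {Kmn}n /asboolP Kmn minn.
have fixC y : K y -> m * y = y * m -> central y.
  move=> Ky my; pose F0 y := K y /\ m * y = y * m.
  have nF0 g : M g -> normalizes g F0.
    move=> Mg z [Kz mz]; have g0 := msub_neq0 Mmax Mg.
    split; first exact: nK.
    have gV0 := divr_invr_neq0 g0; have MV := msubV Mmax Mg.
    apply: (conjr_eq_comm D_div gV0); rewrite conjrK //.
    rewrite conjr_mul_commg //; apply/commr_sym/commrM => //.
    by apply: cK => //; apply/nK/MK => //; exists g^-1, m.
  have nE g : M g -> normalizes g (centralizer F0).
    move=> Mg; apply: conjr_centralizer => //; first exact: (msub_neq0 Mmax).
    by apply/nF0/(msubV Mmax).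
  have KE x : K x -> centralizer F0 x by move=> Kx z [Kz _]; exact: cK.
  have Em : centralizer F0 m by move=> z [].
  have [all|cen|[_ cE]] := normalized_trichotomy D_div Mmax Mmet (centralizer_division F0) nE.
  - by move=> z; apply/esym/all.
  - by exact/cen/KE.
  - by case: nKm; apply: sK => z /KE; exact: cE.
apply: (crossed_product_finite_dim D_div dK cK sK m0 _ _ Kmn) => //.
- exact: nK.
- exact/nK/(msubV Mmax).
- by move=> i ltin /asboolP /minn; rewrite leqNgt ltin.
Qed.
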